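(* Let $A,B\subseteq\mathbb{Z}$ be finite sets with $|A|=3$ and $|B|\ge 2$. Then $|A\widehat{+}B|=|A|+|B|-3$ if and only if $A=B$.
   Context: For finite sets $A,B\subseteq\mathbb{Z}$, the restricted sumset is $A\widehat{+}B=\{a+b: a\in A,\ b\in B,\ a\neq b\}$. A pair $(A,B)$ with $|A|,|B|\ge 2$ satisfying $|A\widehat{+}B|=|A|+|B|-3$ is called a critical pair; throughout the paper all sets considered have at least two elements. *)

(* Defs.v *)
From mathcomp Require Import all_boot all_order all_algebra finmap.

Set Implicit Arguments.
Unset Strict Implicit.
Unset Printing Implicit Defensive.

Local Open Scope fset_scope.
Local Open Scope ring_scope.

Definition restricted_sumset (A B : {fset int}) : {fset int} :=
  [fset a + b | a in A, b in B & a != b].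

Lemma restricted_sumsetP (A B : {fset int}) (x : int) :
  reflect (exists a b : int, [/\ a \in A, b \in B, a <> b & x = a + b])
          (x \in restricted_sumset A B).
Proof.
apply: (iffP (imfset2P _ _ _ _ _)).
- by move=> [a aA [b]]; rewrite !inE => /andP[bB /eqP ab] ->; exists a, b.
- move=> [a [b [aA bB /eqP ab ->]]].
  by exists a => //; exists b => //; rewrite !inE bB.
Qed.

(* Main.v *)
(** Write A = {x < y < z} and let m, M be the minimum and maximum of B. In the
    grid A x B, the monotone lattice paths "x + B, then y + M, z + M" and
    "x + m, y + m, then z + B" each carry |B| + 2 distinct sums, and a sum is
    lost only where a path meets the diagonal. If |A ^+ B| = |B|, both paths
    lose two sums, which forces m = x and M = z; then both paths exhaust
    A ^+ B with 2x and 2z added, so they have the same sums, and comparing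
    these near the ends gives A = B. *)

Require Import Defs.
From mathcomp Require Import all_boot all_order all_algebra finmap zify.

Local Open Scope fset_scope.
Local Open Scope nat_scope.

Import Order.TTheory GRing.Theory Num.Theory.

Lemma fset3_sorted (d : Order.disp_t) (T : orderType d) (A : {fset T}) :
  #|` A| = 3 ->
  exists x y z : T, [/\ (x < y)%O, (y < z)%O & A = [fset x; y; z]].
Proof.
move=> cardA.
have : size (sort <=%O A) = 3 by rewrite size_sort.
have := mem_sort <=%O A; have := sort_lt_sorted A; rewrite fset_uniq.
case: (sort _ _) => [|x [|y [|z []]]] //= /and3P[xy yz _] memA _.
exists x, y, z; split=> //; apply/fsetP=> t.
by rewrite -memA !inE orbA.
Qed.

(** The relation is left arbitrary so that [<=%R] yields the minimum and [>=%R] the maximum; the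
    head of the sorted list is the witness. *)
Lemma fset_extremum (T : choiceType) (r : rel T) (B : {fset T}) :
  total r -> transitive r -> 0 < #|` B| ->
  exists2 m, m \in B & forall b, b \in B -> r m b.
Proof.
move=> r_total r_trans.
rewrite -(size_sort r); have := mem_sort r B; have := sort_sorted r_total B.
case: (sort r B) => [|m s] //= /(order_path_min r_trans)/allP m_min memB _.
exists m; first by rewrite -memB mem_head.
move=> b; rewrite -memB inE => /predU1P[->|/m_min //].
by have := r_total m m; rewrite orbb.
Qed.

Lemma card_translate_add2 (B : {fset int}) (c p q : int) :
    p != q -> (forall b, b \in B -> p <> (c + b)%R /\ q <> (c + b)%R) ->
  #|` p |` (q |` [fset (c + b)%R | b in B])| = #|` B| + 2.
Proof.
move=> pq outB; rewrite !cardfsU1 card_imfset; last exact: addrI.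
rewrite !inE (negbTE pq) /=.
case: imfsetP => [[b /outB[pb _] /pb]//|_].
case: imfsetP => [[b /outB[_ qb] /qb]//|_].
by rewrite addnA addnC.
Qed.

Lemma restricted_sumset_diag (x y z : int) : (x < y)%R -> (y < z)%R ->
  restricted_sumset [fset x; y; z] [fset x; y; z]
    = [fset (x + y)%R; (x + z)%R; (y + z)%R].
Proof.
move=> xy yz; apply/fsetP=> t; apply/restricted_sumsetP/idP.
  by move=> [a [b []]]; rewrite !inE; lia.
rewrite !inE => /orP[/orP[]|] /eqP->.
- by exists x, y; rewrite !inE !eqxx !orbT; split=> //; lia.
- by exists x, z; rewrite !inE !eqxx !orbT; split=> //; lia.
- by exists y, z; rewrite !inE !eqxx !orbT; split=> //; lia.
Qed.

Lemma critical_pair_eq (x y z : int) (B : {fset int}) :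
    (x < y)%R -> (y < z)%R -> 2 <= #|` B| ->
    #|` restricted_sumset [fset x; y; z] B| = #|` B| ->
  B = [fset x; y; z].
Proof.
move=> xy yz B2 cardS; set A := [fset x; y; z] in cardS *.
set S := restricted_sumset A B in cardS *.
have B0 : 0 < #|` B| by apply: leq_trans B2.
have [m mB m_min] := fset_extremum _ <=%R B le_total le_trans B0.
have [M MB M_max] : exists2 M, M \in B & forall b, b \in B -> (b <= M)%R.
  exact: (fset_extremum _ >=%R B ge_total ge_trans B0).
have [xA yA zA] : [/\ x \in A, y \in A & z \in A].
  by rewrite !inE !eqxx !orbT.
have memS a b : a \in A -> b \in B -> a = b \/ (a + b)%R \in S.
  move=> aA bB; have [|/eqP ab] := eqVneq a b; first by left.
  by right; apply/restricted_sumsetP; exists a, b.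
have mM : (m < M)%R.
  rewrite lt_neqAle (m_min _ MB) andbT; apply: contraL B2 => /eqP mM.
  rewrite -ltnNge ltnS -(cardfs1 m); apply/fsubset_leq_card/fsubsetP => b bB.
  by rewrite inE; have := M_max _ bB; have := m_min _ bB; lia.
pose R := (y + M)%R |` ((z + M)%R |` [fset (x + b)%R | b in B]).
pose U := (x + m)%R |` ((y + m)%R |` [fset (z + b)%R | b in B]).
(* As [b <= M], every [x + b] lies below [y + M < z + M]; dually, every [z + b] lies above
   [y + m > x + m]. *)
have cardR : #|` R| = #|` B| + 2.
  by apply: card_translate_add2 => [|b /M_max]; lia.
have cardU : #|` U| = #|` B| + 2.
  by apply: card_translate_add2 => [|b /m_min]; lia.
(* Restoring a single sum [t] gives at most [|B| + 1] elements, too few to cover a path. *)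
have two_lost (P : {fset int}) (t : int) :
    #|` P| = #|` B| + 2 -> ~ (P `<=` t |` S).
  move=> cardP /fsubset_leq_card; rewrite cardP cardfsU1 cardS.
  by case: (_ \notin _); lia.
have subRP (D : {fset int}) : (y + M)%R \in D -> (z + M)%R \in D ->
    (forall b, b \in B -> (x + b)%R \in D) -> R `<=` D.
  move=> yD zD xD; rewrite !fsubUset !fsub1set yD zD /=.
  by apply/fsubsetP => _ /imfsetP[b /xD bD ->].
have subUP (D : {fset int}) : (x + m)%R \in D -> (y + m)%R \in D ->
    (forall b, b \in B -> (z + b)%R \in D) -> U `<=` D.
  move=> xD yD zD; rewrite !fsubUset !fsub1set xD yD /=.
  by apply/fsubsetP => _ /imfsetP[b /zD bD ->].
have memD a b t : a \in A -> b \in B -> (a = b -> (a + b)%R = t) ->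
    (a + b)%R \in t |` S.
  move=> aA bB abt; rewrite inE; apply/orP.
  by have [/abt->|] := memS a b aA bB; [left; rewrite inE | right].
(* If [x] is not in [B], the path [R] meets the diagonal only at [(y, M)] or [(z, M)], and either
   way the lost sum is [M + M]. *)
have xB : x \in B.
  apply/idPn => xB; apply: (two_lost R (M + M)%R cardR).
  apply: subRP => [||b bB]; apply: memD => //; try by move=> ->.
  by move=> xb; rewrite xb bB in xB.
have zB : z \in B.
  apply/idPn => zB; apply: (two_lost U (m + m)%R cardU).
  apply: subUP => [||b bB]; apply: memD => //; try by move=> ->.
  by move=> zb; rewrite zb bB in zB.
(* If [z < M], the only diagonal point on [R] is [(x, x)], so only [x + x] can be lost. *)
have Mz : M = z.
  have := M_max _ zB; rewrite le_eqVlt => /predU1P[//|zM].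
  case: (two_lost R (x + x)%R cardR).
  by apply: subRP => [||b bB]; apply: memD => //; lia.
have mx : m = x.
  have := m_min _ xB; rewrite le_eqVlt => /predU1P[//|xm].
  case: (two_lost U (z + z)%R cardU).
  by apply: subUP => [||b bB]; apply: memD => //; lia.
pose D := (x + x)%R |` ((z + z)%R |` S).
have memD2 a b : a \in A -> b \in B -> (a = b -> a = x \/ a = z) ->
    (a + b)%R \in D.
  move=> aA bB abxz; rewrite !inE.
  have [ab|->] := memS a b aA bB; last by rewrite !orbT.
  by rewrite -ab; case: (abxz ab) => ->; rewrite eqxx ?orbT.
have cardD : #|` D| <= #|` B| + 2.
  by rewrite !cardfsU1 cardS; do 2!case: (_ \notin _); lia.
(* Now [R] meets the diagonal only at [(x, x)] and [(z, z)], so it lies in [D], and the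
   cardinalities force equality. *)
have RD : R = D.
  apply/eqP; rewrite eqEfcard cardR cardD andbT.
  by apply: subRP => [||b bB]; apply: memD2 => //; lia.
have UD : U = D.
  apply/eqP; rewrite eqEfcard cardU cardD andbT.
  by apply: subUP => [||b bB]; apply: memD2 => //; lia.
have RU t : (t \in R) = (t \in U) by rewrite RD UD.
(* In [R], the sum [y + m = y + x] is below [y + M] and [z + M], so it has the form [x + b], whence
   [b = y]. *)
have yB : y \in B.
  have : (y + m)%R \in R by rewrite RU !inE eqxx orbT.
  rewrite !inE => /or3P[/eqP|/eqP|/imfsetP[b bB ybx]]; try lia.
  by rewrite (_ : y = b) //; lia.
apply/fsetP => b; apply/idP/idP; last first.
  by rewrite !inE => /orP[/orP[]|] /eqP->.
(* In [U], the sum [x + b] is [x + x], [y + x] or some [z + b']; the last forces [b = z], because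
   [x + b <= x + z <= z + b']. *)
move=> bB; have : (x + b)%R \in U.
  by rewrite -RU !inE in_imfset // !orbT.
have := M_max _ bB; rewrite Mz !inE.
by move=> bz /or3P[/eqP|/eqP|/imfsetP[b' /m_min b'B]]; lia.
Qed.

Theorem theorem2 (A B : {fset int}) (hA : #|` A| = 3) (hB : 2 <= #|` B|) :
  #|` restricted_sumset A B| = #|` A| + #|` B| - 3 <-> A = B.
Proof.
have [x [y [z [xy yz A_eq]]]] := fset3_sorted _ _ A hA.
(* Since [|A| = 3], the truncated subtraction is exact and leaves [|B|]. *)
rewrite hA addKn; split=> [cardS|<-].
  by rewrite A_eq in cardS *; rewrite (critical_pair_eq x y z B xy yz hB cardS).
rewrite hA A_eq restricted_sumset_diag //.
by rewrite fsetUC cardfsU1 cardfs2 !inE; lia.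
Qed.
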